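(* Let $\mathbb{K}$ be a field. For each partition diagram $\pi$ let $L_\pi:=\sum_{\sigma\le\pi}M_\sigma\in\mathrm{ParQSym}$ and $R_\pi:=\sum_{\sigma\ge\pi}(-1)^{l(\sigma)-l(\pi)}H_\sigma\in\mathrm{ParSym}$. Then $\{L_\pi\}$ in $\mathrm{ParQSym}$ is the dual basis of $\{R_\pi\}$ in $\mathrm{ParSym}$, that is, $\langle L_\rho,R_\pi\rangle=\delta_{\rho,\pi}$ for all partition diagrams $\rho,\pi$.
   Context: **Partition diagrams.** A partition diagram of order $k\ge 0$ is a set partition of $\{1,\dots,k,1',\dots,k'\}$; for $k=0$ the only one is the empty diagram $\emptyset$. For $\pi$ of order $k$ and $\rho$ of order $m$, $\pi\otimes\rho$ is the diagram of order $k+m$ whose blocks are the blocks of $\pi$ and the blocks of $\rho$ with labels shifted by $k$ ($i\mapsto i+k$, $i'\mapsto (i+k)'$). If $k,m\ge1$, $\pi\bullet\rho$ is obtained from $\pi\otimes\rho$ by merging the block containing $k'$ with the block containing $(k+1)'$. The empty diagram is the unit for both operations. A diagram is $\otimes$-irreducible (resp. $\bullet$-irreducible) if it is not $\rho\otimes\sigma$ (resp. $\rho\bullet\sigma$) with $\rho,\sigma$ both non-empty. Every non-empty $\pi$ is uniquely $\pi_1\otimes\cdots\otimes\pi_l$ with all $\pi_i$ non-empty and $\otimes$-irreducible; $l(\pi):=l$, and $l(\emptyset):=0$. **Refinement.** Every non-empty $\pi$ can be uniquely written $\pi=\pi_1\divideontimes_1\pi_2\divideontimes_2\cdots\divideontimes_{n-1}\pi_n$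 with each $\divideontimes_i\in\{\otimes,\bullet\}$ and each $\pi_i$ non-empty and both $\otimes$- and $\bullet$-irreducible (on non-empty diagrams $\otimes$ and $\bullet$ associate with each other, so no brackets are needed). Put $S(\pi)=\{i\in\{1,\dots,n-1\}:\divideontimes_i=\otimes\}$. For non-empty $\pi,\sigma$ write $\pi\sim\sigma$ if their sequences $(\pi_1,\dots,\pi_n)$ and $(\sigma_1,\dots,\sigma_m)$ are equal; $\pi\le\sigma$ ($\pi$ refines $\sigma$, $\sigma$ coarsens $\pi$) if $\pi\sim\sigma$ and $S(\sigma)\subseteq S(\pi)$. The empty diagram is related only to itself, with $\emptyset\le\emptyset$. **Pairing.** $\mathrm{ParSym}$ and $\mathrm{ParQSym}$ are the $\mathbb{K}$-vector spaces with bases $\{H_\pi\}$ and $\{M_\pi\}$ respectively, indexed by all partition diagrams, and $\langle\cdot,\cdot\rangle:\mathrm{ParQSym}\otimes\mathrm{ParSym}\to\mathbb{K}$ is the bilinear form with $\langle M_\rho,H_\pi\rangle=\delta_{\rho,\pi}$. *)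

(* Defs.v *)
From HB Require Import structures.
From mathcomp Require Import all_boot all_order all_algebra.

Set Implicit Arguments.
Unset Strict Implicit.
Unset Printing Implicit Defensive.

Import GRing.Theory.

Local Open Scope ring_scope.

(* The label i (1 <= i <= k) is [inl (i-1)], the label i' is [inr (i-1)]. *)
Definition labels (k : nat) : finType := ('I_k + 'I_k)%type.

Definition diagram_of (k : nat) : Type :=
  {P : {set {set labels k}} | partition P [set: labels k]}.

HB.instance Definition _ k := Finite.on (diagram_of k).

Definition diagram : Type := {k : nat & diagram_of k}.

HB.instance Definition _ := Choice.on diagram.

Definition Diagram k (P : {set {set labels k}})
    (hP : partition P [set: labels k]) : diagram :=
  Tagged diagram_of (exist (fun P => is_true (partition P _)) P hP : diagram_of k).

Definition diagram_order (p : diagram) : nat := tag p.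

Section Operations.

Definition lemb k m (x : labels k) : labels (k + m) :=
  match x with inl i => inl (lshift m i) | inr i => inr (lshift m i) end.

Definition remb k m (x : labels m) : labels (k + m) :=
  match x with inl i => inl (rshift k i) | inr i => inr (rshift k i) end.

Definition tensor_blocks k m (P : {set {set labels k}})
    (Q : {set {set labels m}}) : {set {set labels (k + m)}} :=
  (fun B : {set labels k} => @lemb k m @: B) @: P
    :|: (fun B : {set labels m} => @remb k m @: B) @: Q.

Definition merge_blocks (T : finType) (P : {set {set T}}) (a b : T) :=
  (pblock P a :|: pblock P b) |: (P :\ pblock P a :\ pblock P b).

Lemma lemb_inj k m : injective (@lemb k m).
Proof. by move=> [i|i] [j|j] //= [/= e]; congr (_ _); apply: val_inj. Qed.

Lemma remb_inj k m : injective (@remb k m).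
Proof.
by move=> [i|i] [j|j] //= [/= /eqP]; rewrite eqn_add2l => /eqP e;
   congr (_ _); apply: val_inj.
Qed.

Lemma lemb_remb k m (x : labels k) (y : labels m) : lemb m x != remb k y.
Proof.
case: x y => [i|i] [j|j] //=; apply/eqP => -[/= e];
  by have := ltn_ord i; rewrite e ltnNge leq_addr.
Qed.

Lemma labels_split k m (z : labels (k + m)) :
  (exists x, z = lemb m x) \/ (exists y, z = remb k y).
Proof.
case: z => z; case: (split_ordP z) => j ->;
  [left; exists (inl j)|right; exists (inl j)
  |left; exists (inr j)|right; exists (inr j)] => //.
Qed.

Lemma tensor_partition k m (p : diagram_of k) (q : diagram_of m) :
  partition (tensor_blocks (val p) (val q)) [set: labels (k + m)].
Proof.
case: p q => P /= pP [Q /= pQ].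
have [/eqP cP tP P0] := and3P pP; have [/eqP cQ tQ Q0] := and3P pQ.
apply/and3P; split.
- rewrite eqEsubset subsetT /=; apply/subsetP => z _.
  have [[x ->]|[y ->]] := labels_split z.
    have : x \in cover P by rewrite cP inE.
    case/bigcupP => B BP xB; apply/bigcupP; exists (@lemb k m @: B).
      by rewrite inE imset_f.
    exact: imset_f.
  have : y \in cover Q by rewrite cQ inE.
  case/bigcupP => B BQ yB; apply/bigcupP; exists (@remb k m @: B).
    by rewrite inE [X in _ || X]imset_f ?orbT.
  exact: imset_f.
- apply/trivIsetP => A B.
  move: tP tQ => /trivIsetP tP /trivIsetP tQ.
  case/setUP => /imsetP[A' A'P ->]; case/setUP => /imsetP[B' B'P ->] nAB.
  + rewrite -setI_eq0 -imsetI; last by move=> ? ? _ _; apply: lemb_inj.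
    rewrite imset_eq0 setI_eq0; apply: tP => //.
    by apply: contraNneq nAB => ->.
  + apply/pred0P => z /=; apply/negP => /andP[/imsetP[x _ ->] /imsetP[y _ e]].
    by have := lemb_remb x y; rewrite e eqxx.
  + apply/pred0P => z /=; apply/negP => /andP[/imsetP[x _ ->] /imsetP[y _ e]].
    by have := lemb_remb y x; rewrite -e eqxx.
  + rewrite -setI_eq0 -imsetI; last by move=> ? ? _ _; apply: remb_inj.
    rewrite imset_eq0 setI_eq0; apply: tQ => //.
    by apply: contraNneq nAB => ->.
- apply/negP => /setUP[] /imsetP[A AP] /esym/eqP; rewrite imset_eq0 => /eqP A0.
    by rewrite A0 (negbTE P0) in AP.
  by rewrite A0 (negbTE Q0) in AP.
Qed.

Lemma merge_partition (T : finType) (P : {set {set T}}) (a b : T) :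
  partition P [set: T] -> partition (merge_blocks P a b) [set: T].
Proof.
move=> /and3P[/eqP cP tP P0].
have aP : pblock P a \in P by apply: pblock_mem; rewrite cP inE.
have bP : pblock P b \in P by apply: pblock_mem; rewrite cP inE.
have disj C : C \in P -> C != pblock P a -> C != pblock P b ->
    [disjoint pblock P a :|: pblock P b & C].
  move=> CP Ca Cb; move/trivIsetP: tP => tP.
  rewrite -setI_eq0 setIUl setU_eq0 !setI_eq0.
  by rewrite !tP // eq_sym.
apply/and3P; split.
- rewrite eqEsubset subsetT /=; apply/subsetP => z _.
  have : z \in cover P by rewrite cP inE.
  case/bigcupP => B BP zB; apply/bigcupP.
  have [Ba|nBa] := eqVneq B (pblock P a).
    exists (pblock P a :|: pblock P b); first exact: setU11.
    by rewrite inE -Ba zB.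
  have [Bb|nBb] := eqVneq B (pblock P b).
    exists (pblock P a :|: pblock P b); first exact: setU11.
    by rewrite inE -Bb zB orbT.
  by exists B => //; rewrite !inE nBa nBb BP orbT.
- apply/trivIsetP => A B; rewrite !inE.
  case/predU1P => [->|/and3P[Ab Aa AP]]; case/predU1P => [->|/and3P[Bb Ba BP]].
  + by rewrite eqxx.
  + by move=> _; apply: disj.
  + by move=> _; rewrite disjoint_sym; apply: disj.
  + by move/trivIsetP: tP; apply.
- rewrite !inE negb_or !negb_and P0 !orbT andbT eq_sym setU_eq0.
  by rewrite negb_and; apply/orP; left; apply: contraNneq P0 => <-.
Qed.

End Operations.

Lemma empty_partition : partition (set0 : {set {set labels 0}}) [set: labels 0].
Proof.
apply/and3P; split; rewrite ?inE //; last by apply/trivIsetP => A B; rewrite inE.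
by rewrite /cover big_set0; apply/eqP/setP => -[] [].
Qed.

Definition empty_diagram : diagram := Diagram empty_partition.

Definition tensor (p q : diagram) : diagram :=
  Diagram (tensor_partition (tagged p) (tagged q)).

Definition bullet (p q : diagram) : diagram :=
  match p, q with
  | existT k.+1 P, existT m.+1 Q =>
      Diagram (merge_partition (inr (lshift m.+1 ord_max))
                 (inr (rshift k.+1 ord0)) (tensor_partition P Q))
  | existT 0 _, _ => q
  | _, existT 0 _ => p
  end.

(* Imported only here: classical_sets shadows finset's partition, cover, ... *)
From mathcomp Require Import finmap.
From mathcomp Require Import boolp classical_sets functions cardinality fsbigop.
From mathcomp Require Import monalg.

Definition tensor_irreducible (p : diagram) : Prop :=
  forall r s : diagram, p = tensor r s -> r = empty_diagram \/ s = empty_diagram.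

Definition bullet_irreducible (p : diagram) : Prop :=
  forall r s : diagram, p = bullet r s -> r = empty_diagram \/ s = empty_diagram.

Definition tensor_factorization (p : diagram) (s : seq diagram) : Prop :=
  (forall x, x \in s -> x <> empty_diagram /\ tensor_irreducible x) /\
  p = foldr tensor empty_diagram s.

(* The factorization exists and is unique; for [empty_diagram] it is [::]. *)
Definition tensor_length (p : diagram) : nat :=
  size (xget [::] (tensor_factorization p : set (seq diagram))).

Inductive joint := Tensor | Bullet.

Definition apply_joint (o : joint) : diagram -> diagram -> diagram :=
  match o with Tensor => tensor | Bullet => bullet end.

(* [eval_fact x [:: (o1, x1); ...; (on, xn)]] is x o1 x1 o2 ... on xn. *)
Definition eval_fact (x : diagram) (t : seq (joint * diagram)) : diagram :=
  foldl (fun acc ox => apply_joint ox.1 acc ox.2) x t.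

Definition fact_factors (x : diagram) (t : seq (joint * diagram)) : seq diagram :=
  x :: unzip2 t.

Definition fact_tensors (t : seq (joint * diagram)) : set nat :=
  [set i | (0 < i <= size t)%N /\ nth Bullet (unzip1 t) i.-1 = Tensor]%classic.

Definition refined_factorization (p x : diagram) (t : seq (joint * diagram)) :
    Prop :=
  (forall y, y \in fact_factors x t ->
     [/\ y <> empty_diagram, tensor_irreducible y & bullet_irreducible y]) /\
  p = eval_fact x t.

(* [refines p q] is p <= q. The refined factorization of a non-empty diagram
   is unique, so quantifying existentially over it loses nothing. *)
Definition refines (p q : diagram) : Prop :=
  (p = empty_diagram /\ q = empty_diagram) \/
  [/\ p <> empty_diagram, q <> empty_diagram &
   exists x y t u,
     [/\ refined_factorization p x t, refined_factorization q y u,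
         fact_factors x t = fact_factors y u &
         (fact_tensors u `<=` fact_tensors t)%classic]].

Definition ParSym (K : fieldType) := {malg K[diagram]}.
Definition ParQSym (K : fieldType) := {malg K[diagram]}.

Definition Hpar (K : fieldType) (p : diagram) : ParSym K := << p >>.
Definition Mpar (K : fieldType) (p : diagram) : ParQSym K := << p >>.

Definition pairing (K : fieldType) (f : ParQSym K) (g : ParSym K) : K :=
  \sum_(p <- msupp f) f@_p * g@_p.

Section Pairing.
Variable K : fieldType.
Implicit Types (f : ParQSym K) (g : ParSym K).

Lemma pairingEw (d : {fset diagram}) f g :
  (msupp f `<=` d)%fset -> pairing f g = \sum_(p <- d) f@_p * g@_p.
Proof.
move=> fd; rewrite /pairing (big_fset_incl _ fd) //.
by move=> p _ /mcoeff_outdom ->; rewrite mul0r.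
Qed.

Lemma pairing_linearl a f f' g :
  pairing (a *: f + f') g = a * pairing f g + pairing f' g.
Proof.
pose d := (msupp f `|` msupp f' `|` msupp (a *: f + f'))%fset.
rewrite !(@pairingEw d) ?fsubsetUr //; last 2 first.
- by rewrite /d -fsetUA fsubsetU // fsubsetUl orbT.
- by rewrite /d -fsetUA fsubsetUl.
rewrite mulr_sumr -big_split /=; apply: eq_bigr => p _.
by rewrite mcoeffD mcoeffZ mulrDl mulrA.
Qed.

Lemma pairing_linearr a f g g' :
  pairing f (a *: g + g') = a * pairing f g + pairing f g'.
Proof.
rewrite mulr_sumr -big_split /=; apply: eq_bigr => p _.
by rewrite mcoeffD mcoeffZ mulrDr mulrCA.
Qed.

Lemma pairing_basis p q : pairing (Mpar K p) (Hpar K q) = (p == q)%:R.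
Proof.
rewrite /Mpar /Hpar (@pairingEw [fset p]%fset) ?msuppU_le // big_seq_fset1.
rewrite [X in X * _]mcoeffU mcoeffU [p == p]eqxx mulr1n mul1r eq_sym.
reflexivity.
Qed.

End Pairing.

Lemma order_bullet p q :
  diagram_order (bullet p q) = (diagram_order p + diagram_order q)%N.
Proof. by case: p q => [[|k] P] [[|m] Q] //=; rewrite addn0. Qed.

Lemma order_refines p q : refines p q -> diagram_order p = diagram_order q.
Proof.
have oE x t :
      diagram_order (eval_fact x t) = sumn (map diagram_order (fact_factors x t)).
  rewrite /eval_fact /=; elim: t x => [|[o y] t IH] x /=; first by rewrite addn0.
  by rewrite IH addnA; congr addn; case: o => //=; rewrite order_bullet.
case=> [[-> ->] //|[_ _ [x [y [t [u [[_ ->] [_ ->] e _]]]]]]].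
by rewrite !oE e.
Qed.

Lemma finite_same_order k : finite_set [set p : diagram | diagram_order p = k]%classic.
Proof.
apply: (@sub_finite_set _ _ (range (fun P : diagram_of k => Tagged diagram_of P))).
  by move=> [j P] /= jk; subst j; exists P.
exact: finite_image.
Qed.

(* A sum over an infinite support would be 0 by convention; these two lemmas
   rule this out for [Lpar] and [Rpar]. *)
Lemma finite_refining p : finite_set [set s | refines s p]%classic.
Proof.
by apply: sub_finite_set (finite_same_order (diagram_order p)) => s /= /order_refines.
Qed.

Lemma finite_coarsening p : finite_set [set s | refines p s]%classic.
Proof.
by apply: sub_finite_set (finite_same_order (diagram_order p)) => s /= /order_refines.
Qed.

Definition Lpar (K : fieldType) (p : diagram) : ParQSym K :=
  \sum_(s \in [set s | refines s p]%classic) Mpar K s.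

(* Here tensor_length s <= tensor_length p: the exponent is not positive. *)
Definition Rpar (K : fieldType) (p : diagram) : ParSym K :=
  \sum_(s \in [set s | refines p s]%classic)
    (-1 : K) ^ ((tensor_length s)%:Z - (tensor_length p)%:Z) *: Hpar K s.

(* Main.v *)
(* Cut a diagram of order n between positions k and k + 1.  It is a product of
   diagrams of orders k and n - k for at most one of the two operations, and both
   factors are then its restrictions to either side of the cut.  Hence the
   refined factorization is unique, and the diagrams with a given sequence of m
   factors are in bijection with the vectors in {tensor, bullet}^(m-1).  The
   tensor length is one plus the number of tensors, so the pairing of L_rho and
   R_pi is a signed sum over a Boolean interval, which splits as a product over
   the joints. *)
Require Import Defs.
From mathcomp Require Import all_boot all_order all_algebra.
From mathcomp Require Import zify.

Set Implicit Arguments.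
Unset Strict Implicit.
Unset Printing Implicit Defensive.

Import GRing.Theory.
Local Open Scope ring_scope.

(** * Diagrams as relations *)

(* Addressing labels by natural numbers avoids casts between [labels (k + m)]
   types when diagrams are compared. *)
Definition label k (b : bool) (i : nat) : option (labels k) :=
  omap (fun j => if b then inr j else inl j) (insub i).

(** The equivalence relation whose classes are the blocks. Positions count from 0, [true] marks the
    primed row, and positions outside the diagram are linked to nothing. *)
Definition linked (p : diagram) (b : bool) (i : nat) (c : bool) (j : nat) :=
  match label (tag p) b i, label (tag p) c j with
  | Some u, Some v => v \in pblock (val (tagged p)) u
  | _, _ => false
  end.

Lemma label_oversize k b i : (k <= i)%N -> label k b i = None.
Proof. by move=> ki; rewrite /label insubF // ltnNge ki. Qed.

Lemma label_some k (u : labels k) :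
  exists b i, (i < k)%N /\ label k b i = Some u.
Proof.
by case: u => i; [exists false|exists true]; exists i; split => //;
   rewrite /label valK.
Qed.

Lemma label_ltn k b i : (i < k)%N -> exists u, label k b i = Some u.
Proof. by move=> ik; rewrite /label (insubT (fun i => i < k)%N ik); eexists. Qed.

Lemma label_lshift k m b i : (i < k)%N ->
  label (k + m) b i = omap (@lemb k m) (label k b i).
Proof.
move=> ik; rewrite /label !insubT ?(leq_trans ik (leq_addr _ _)) // => H.
by case: b => /=; congr (Some (_ _)); apply: val_inj.
Qed.

Lemma label_rshift k m b i : (k <= i)%N ->
  label (k + m) b i = omap (@remb k m) (label m b (i - k)).
Proof.
move=> ki; rewrite /label; case: (ltnP (i - k) m) => im; last first.
  by rewrite !insubF //; lia.
rewrite !insubT //; first lia.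
move=> H; case: b => /=; congr (Some (_ _)); apply: val_inj => /=; lia.
Qed.

Lemma partition_of (p : diagram) :
  partition (val (tagged p)) [set: labels (tag p)].
Proof. exact: (valP (tagged p)). Qed.

Lemma linked_refl p b i : (i < tag p)%N -> linked p b i b i.
Proof.
move=> /(label_ltn b)[u eu]; rewrite /linked eu mem_pblock.
by rewrite (cover_partition (partition_of p)) inE.
Qed.

(** A partition is recovered from its equivalence relation. Identities between diagrams thus become
    Boolean identities between links. *)
Lemma eq_diagram p q : tag p = tag q ->
  (forall b i c j, (i < tag p)%N -> (j < tag p)%N ->
     linked p b i c j = linked q b i c j) -> p = q.
Proof.
case: p q => [k P] [m Q] /= km; subst m => H; congr existT; apply: val_inj.
rewrite -(equivalence_partition_pblock (valP P)).
rewrite -(equivalence_partition_pblock (valP Q)).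
apply: eq_imset => u; apply/setP => v; rewrite !inE.
have [b [i [ik eu]]] := label_some u; have [c [j [jk ev]]] := label_some v.
by have := H b i c j ik jk; rewrite /linked /= eu ev.
Qed.

Lemma diagram_nonempty p : p <> empty_diagram <-> (0 < diagram_order p)%N.
Proof.
split=> [p0|+ e]; last by rewrite e.
by rewrite lt0n; apply/eqP => k0; apply: p0; apply: eq_diagram => // b i c j;
   rewrite -/(diagram_order p) k0.
Qed.

(** * Links in the two products *)

Lemma pblock_tensorl k m (P : diagram_of k) (Q : diagram_of m) (x : labels k) :
  pblock (tensor_blocks (val P) (val Q)) (lemb m x) =
  @lemb k m @: pblock (val P) x.
Proof.
have xP : x \in cover (val P) by rewrite (cover_partition (valP P)) inE.
apply: def_pblock; first by have /and3P[] := tensor_partition P Q.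
  by rewrite inE imset_f // pblock_mem.
by rewrite imset_f // mem_pblock.
Qed.

Lemma pblock_tensorr k m (P : diagram_of k) (Q : diagram_of m) (x : labels m) :
  pblock (tensor_blocks (val P) (val Q)) (remb k x) =
  @remb k m @: pblock (val Q) x.
Proof.
have xQ : x \in cover (val Q) by rewrite (cover_partition (valP Q)) inE.
apply: def_pblock; first by have /and3P[] := tensor_partition P Q.
  by rewrite inE orbC imset_f // pblock_mem.
by rewrite imset_f // mem_pblock.
Qed.

Lemma mem_tensor_blocks k m (P : diagram_of k) (Q : diagram_of m) :
  let t := pblock (tensor_blocks (val P) (val Q)) in
  [/\ forall x y, (lemb m y \in t (lemb m x)) = (y \in pblock (val P) x),
      forall x y, (remb k y \in t (lemb m x)) = false,
      forall x y, (lemb m y \in t (remb k x)) = false &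
      forall x y, (remb k y \in t (remb k x)) = (y \in pblock (val Q) x)].
Proof.
split=> x y; rewrite ?pblock_tensorl ?pblock_tensorr.
- by rewrite mem_imset //; apply: lemb_inj.
- by apply/imsetP => -[z _ /eqP]; rewrite eq_sym (negbTE (lemb_remb _ _)).
- by apply/imsetP => -[z _ /eqP]; rewrite (negbTE (lemb_remb _ _)).
- by rewrite mem_imset //; apply: remb_inj.
Qed.

(** Only the blocks of [a] and [b] change, so three cases arise: the block of [u] is that of [a],
    that of [b], or neither. The formula allows [a] and [b] to share a block. *)
Lemma mem_merge_blocks (T : finType) (P : {set {set T}}) (a b u v : T) :
  partition P [set: T] ->
  (v \in pblock (merge_blocks P a b) u) =
  [|| v \in pblock P u,
      (a \in pblock P u) && (v \in pblock P b) |
      (b \in pblock P u) && (v \in pblock P a)].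
Proof.
move=> hP; have hM := merge_partition a b hP.
have [/eqP cP tP P0] := and3P hP; have [_ tM _] := and3P hM.
have inP x : x \in cover P by rewrite cP inE.
have pbE x y : (y \in pblock P x) = (pblock P x == pblock P y).
  by rewrite eq_pblock.
have UE w : pblock P w = pblock P a \/ pblock P w = pblock P b ->
    pblock (merge_blocks P a b) w = pblock P a :|: pblock P b.
  move=> h; apply: def_pblock => //; first exact: setU11.
  by rewrite inE !pbE; case: h => ->; rewrite eqxx ?orbT.
have [ua|nua] := eqVneq (pblock P u) (pblock P a).
  rewrite UE; last by left.
  by rewrite inE !pbE ua eqxx /=; do ![case: (_ == _)].
have [ub|nub] := eqVneq (pblock P u) (pblock P b).
  rewrite UE; last by right.
  by rewrite inE !pbE ub eqxx /=; do ![case: (_ == _)].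
rewrite !pbE (negbTE nua) (negbTE nub) !orbF -pbE.
rewrite (@def_pblock _ (merge_blocks P a b) (pblock P u)) ?mem_pblock //.
by rewrite !inE nua nub pblock_mem // orbT.
Qed.

Definition is_bullet (o : joint) : bool := if o is Bullet then true else false.

Lemma order_joint o p q :
  diagram_order (apply_joint o p q) = (diagram_order p + diagram_order q)%N.
Proof. by case: o => //; apply: order_bullet. Qed.

Lemma linked_tensor p q b i c j : let k := diagram_order p in
  linked (tensor p q) b i c j =
  if (i < k)%N then (j < k)%N && linked p b i c j
  else (k <= j)%N && linked q b (i - k) c (j - k).
Proof.
case: p q => [k P] [m Q] /=; rewrite /diagram_order /linked /=.
have [H1 H2 H3 H4] := mem_tensor_blocks P Q.
case: (ltnP i k) => ik; case: (ltnP j k) => jk /=;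
  rewrite ?(label_lshift _ _ ik) ?(label_lshift _ _ jk)
          ?(label_rshift _ _ ik) ?(label_rshift _ _ jk);
  by case: (label _ b _) => //= u; case: (label _ c _) => //= v.
Qed.

Lemma linked_oversize p b i c j :
  (diagram_order p <= i)%N \/ (diagram_order p <= j)%N ->
  linked p b i c j = false.
Proof.
rewrite /diagram_order /linked; case=> h; rewrite (label_oversize _ h) //.
by case: label.
Qed.

(** A link across the cut must pass through the merged labels, the last primed label of [p] and the
    first primed label of [q]; merging creates no new link within one side. Empty factors are
    covered as well: for empty [q] the mixed cases are false because positions out of range are
    never linked. *)
Lemma linked_joint o p q b i c j : let k := diagram_order p in
  linked (apply_joint o p q) b i c j =
  if (i < k)%N then
    if (j < k)%N then linked p b i c j
    else [&& is_bullet o, linked p b i true k.-1 & linked q true 0 c (j - k)]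
  else
    if (j < k)%N then
      [&& is_bullet o, linked p true k.-1 c j & linked q b (i - k) true 0]
    else linked q b (i - k) c (j - k).
Proof.
case: o => /=; first by rewrite linked_tensor; case: ltnP; case: ltnP.
have [p0|] := posnP (diagram_order p).
  rewrite p0 !ltn0 !subn0; have -> // : bullet p q = q.
  by case: p p0 => [[|k] P] // _; case: q => -[|m] Q.
have [q0|] := posnP (diagram_order q).
  move=> p0; have -> : bullet p q = p.
    by case: p q p0 q0 => [[|k] P] [[|m] Q].
  have qF b' i' c' j' : linked q b' i' c' j' = false.
    by apply: linked_oversize; left; rewrite q0.
  rewrite !qF !andbF; case: ltnP => ik; case: ltnP => jk //;
    by apply: linked_oversize; auto.
case: p => [[|k] P]; case: q => [[|m] Q] // _ _.
(* Here [p] has order [k.+1], so the two merged primed labels sit at positions [k] and [k.+1] of the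
   tensor product. *)
transitivity (linked (tensor (existT _ k.+1 P) (existT _ m.+1 Q)) b i c j ||
  (linked (tensor (existT _ k.+1 P) (existT _ m.+1 Q)) b i true k &&
   linked (tensor (existT _ k.+1 P) (existT _ m.+1 Q)) true k.+1 c j) ||
  (linked (tensor (existT _ k.+1 P) (existT _ m.+1 Q)) b i true k.+1 &&
   linked (tensor (existT _ k.+1 P) (existT _ m.+1 Q)) true k c j)).
  have e1 : label (k.+1 + m.+1) true k =
     Some (inr (lshift m.+1 ord_max) : labels _).
    rewrite /label insubT; first lia.
    by move=> H; congr (Some (inr _)); apply: val_inj.
  have e2 : label (k.+1 + m.+1) true k.+1 =
     Some (inr (rshift k.+1 ord0) : labels _).
    rewrite /label insubT; first lia.
    by move=> H; congr (Some (inr _)); apply: val_inj => /=; rewrite addn0.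
  rewrite /linked /= e1 e2.
  case: (label _ b i) => [u|] //; case: (label _ c j) => [v|] //=.
    rewrite mem_merge_blocks ?orbA //; exact: tensor_partition.
  by rewrite !andbF.
rewrite !linked_tensor /diagram_order /= ltnSn !ltnn !subnn.
case: (ltnP i k.+1) => ik; case: (ltnP j k.+1) => jk //=.
all: by rewrite ?andbF ?orbF // andbC.
Qed.

Lemma linked_trans p b i c j d l :
  linked p b i c j -> linked p b i d l = linked p c j d l.
Proof.
rewrite /linked; case: label => // u; case: label => // v uv.
by have [_ tP _] := and3P (partition_of p); rewrite (same_pblock tP uv).
Qed.

(** An equivalence relation restricted to consecutive positions is again one, and its classes form
    the required diagram. *)
Lemma exists_window p k m : (k + m <= diagram_order p)%N ->
  exists q, diagram_order q = m /\ forall b i c j, (i < m)%N -> (j < m)%N ->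
    linked q b i c j = linked p b (k + i) c (k + j).
Proof.
move=> kmp.
pose pos (u : labels m) :=
  match u with inl i => (false, i : nat) | inr i => (true, i : nat) end.
pose R u v := linked p (pos u).1 (k + (pos u).2) (pos v).1 (k + (pos v).2).
have eqR : {in [set: labels m] & &, equivalence_rel R}.
  move=> u v w _ _ _; split; last exact: linked_trans.
  apply: linked_refl; apply: leq_trans kmp; rewrite ltn_add2l.
  by case: w => w; apply: ltn_ord.
exists (Diagram (equivalence_partitionP eqR)); split=> // b i c j im jm.
have posE b' i' u : label m b' i' = Some u -> pos u = (b', i').
  by rewrite /label; case: insubP => //= n _ <- [<-]; case: b'.
have [u eu] := label_ltn b im; have [v ev] := label_ltn c jm.
rewrite /linked /= eu ev (pblock_equivalence_partition eqR) ?inE //.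
by rewrite /R (posE _ _ _ eu) (posE _ _ _ ev).
Qed.

From mathcomp Require Import finmap boolp classical_sets cardinality fsbigop.
From mathcomp Require Import monalg.

(** * The refined factorization *)

(** A non-empty middle factor keeps the two cuts apart. For empty [q] with a tensor followed by a
    bullet, the left side would be the bullet product of [p] and [r] and the right side their tensor
    product. *)
Lemma joint_assoc o1 o2 p q r : (0 < diagram_order q)%N ->
  apply_joint o2 (apply_joint o1 p q) r = apply_joint o1 p (apply_joint o2 q r).
Proof.
move=> q0; apply: eq_diagram => [|b i c j _ _].
  by rewrite -!/(diagram_order _) !order_joint addnA.
rewrite !linked_joint !order_joint !subnDA.
set k := diagram_order p; set m := diagram_order q.
have -> : ((k + m).-1 < k)%N = false by lia.
have -> : ((k + m).-1 - k = m.-1)%N by lia.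
have -> : (0 < m)%N by [].
(* Truncated subtraction sends every position left of the first cut to 0, whence the extra
   disjunct. *)
have E x : (x - k < m)%N = (x < k + m)%N || (x < k)%N by lia.
have F x : (x < k)%N -> (x < k + m)%N by lia.
rewrite !E; case: (ltnP i k) => ik; case: (ltnP j k) => jk;
  rewrite ?(F i ik) ?(F j jk) ?orbF //=.
- by case: ifP => // _; rewrite -!andbA; do !bool_congr.
- by case: ifP => // _; rewrite -!andbA; do !bool_congr.
Qed.

(** Both factors are restrictions of the product to the sides of the common cut, and the operation
    can be read off at the cut itself. *)
Lemma joint_cancel o o' p q p' q' :
  (0 < diagram_order p)%N -> (0 < diagram_order q)%N ->
  diagram_order p = diagram_order p' ->
  apply_joint o p q = apply_joint o' p' q' -> [/\ o = o', p = p' & q = q'].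
Proof.
move=> p0 q0 pp e.
have qq : diagram_order q = diagram_order q'.
  by have := congr1 diagram_order e; rewrite !order_joint; lia.
have l b i c j : linked (apply_joint o p q) b i c j =
                 linked (apply_joint o' p' q') b i c j by rewrite e.
have ep : p = p'.
  apply: eq_diagram => // b i c j; rewrite -/(diagram_order p) => ik jk.
  by have := l b i c j; rewrite !linked_joint -pp ik jk.
have eq : q = q'.
  apply: eq_diagram => // b i c j _ _.
  have := l b (diagram_order p + i)%N c (diagram_order p + j)%N.
  by rewrite !linked_joint -pp !ltnNge !leq_addr /= !addKn.
(* The two primed labels adjacent to the cut are linked exactly when the operation is a bullet; they
   exist because both factors are non-empty. *)
split=> //; have := l true (diagram_order p).-1 true (diagram_order p).
rewrite !linked_joint -ep -eq ltnn subnn prednK // leqnn.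
by rewrite !linked_refl // ?prednK //; case: (o); case: (o').
Qed.

(* [r] is the window of the diagram between the two cuts. *)
Lemma joint_common_factor o o' p q p' q' :
  apply_joint o p q = apply_joint o' p' q' ->
  (0 < diagram_order p)%N -> (diagram_order p < diagram_order p')%N ->
  exists2 r, (0 < diagram_order r)%N & q = apply_joint o' r q'.
Proof.
move=> e p0 pp'; set k := diagram_order p in p0 pp' *.
have [|r [r_order rE]] := @exists_window p' k (diagram_order p' - k)%N.
  by rewrite subnKC // ltnW.
set m := diagram_order p' in pp' r_order rE.
exists r; first by rewrite r_order subn_gt0.
have := congr1 diagram_order e; rewrite !order_joint -/k -/m => eo.
apply: eq_diagram => [|b i c j _ _].
  by rewrite -!/(diagram_order _) order_joint r_order; lia.
(* The links of [q] are those of the whole product beyond position [k], so they can be computed from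
   the other decomposition. *)
have -> : linked q b i c j = linked (apply_joint o p q) b (k + i) c (k + j).
  by rewrite linked_joint -/k !ltnNge !leq_addr /= !addKn.
rewrite e !linked_joint r_order -/m.
have E x : (k + x < m)%N = (x < m - k)%N by lia.
have F x : (k + x - m = x - (m - k))%N by lia.
have mk : ((m - k).-1 < m - k)%N by lia.
have -> : m.-1 = (k + (m - k).-1)%N by lia.
rewrite !E !F; case: ifP => ik; case: ifP => jk; by rewrite ?rE.
Qed.

Definition factor (x : diagram) : Prop :=
  [/\ x <> empty_diagram, tensor_irreducible x & bullet_irreducible x].

Lemma factor_order x : factor x -> (0 < diagram_order x)%N.
Proof. by case=> /diagram_nonempty. Qed.

Lemma factor_joint o p q : factor (apply_joint o p q) ->
  (0 < diagram_order p)%N -> (0 < diagram_order q)%N -> False.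
Proof.
move=> [_ ht hb] /diagram_nonempty p0 /diagram_nonempty q0.
by case: o ht hb => [/(_ p q erefl) h _|_ /(_ p q erefl) h]; case: h.
Qed.

Lemma order_eval_fact x t :
  (diagram_order x <= diagram_order (eval_fact x t))%N.
Proof.
elim/last_ind: t => // t [o y] IH; rewrite /eval_fact foldl_rcons order_joint.
exact: leq_trans IH (leq_addr _ _).
Qed.

(** Evaluation brackets to the left, so splitting at an inner joint needs associativity; the middle
    piece of each rebracketing begins with [y] and is therefore non-empty. *)
Lemma eval_fact_cat x t o y u : (0 < diagram_order y)%N ->
  eval_fact x (t ++ (o, y) :: u) =
  apply_joint o (eval_fact x t) (eval_fact y u).
Proof.
move=> y0; elim/last_ind: u => [|u [o' z] IH].
  by rewrite cats1 /eval_fact foldl_rcons.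
rewrite -rcons_cons -rcons_cat /eval_fact !foldl_rcons /= -!/(eval_fact _ _) IH.
by rewrite joint_assoc // (leq_trans y0) ?order_eval_fact.
Qed.

Lemma refined_factorization_head p x t : refined_factorization p x t -> factor x.
Proof. by case=> h _; apply: h; rewrite mem_head. Qed.

Lemma refined_factorization_order p x t :
  refined_factorization p x t -> (0 < diagram_order p)%N.
Proof.
move=> h; have /factor_order x0 := refined_factorization_head h.
by case: h => _ ->; apply: leq_trans x0 (order_eval_fact _ _).
Qed.

Lemma refined_factorization_rcons p x t o z :
  refined_factorization p x (rcons t (o, z)) ->
  [/\ refined_factorization (eval_fact x t) x t, factor z &
      p = apply_joint o (eval_fact x t) z].
Proof.
rewrite /refined_factorization /fact_factors /unzip2 map_rcons.
rewrite /eval_fact foldl_rcons => -[h ->]; split=> //; last first.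
  by apply: h; rewrite inE mem_rcons mem_head orbT.
split=> // y yt; apply: h; move: yt; rewrite !inE mem_rcons inE.
by case/orP=> ->; rewrite ?orbT.
Qed.

(* Two distinct last cuts would make one of the two last factors reducible. *)
Lemma refined_factorization_unique p x t y u :
  refined_factorization p x t -> refined_factorization p y u ->
  x = y /\ t = u.
Proof.
elim/last_ind: t p u => [|t [o z] IH] p u; case/lastP: u => [|u [o' z']].
- by move=> [_ ->] [_].
(* A single irreducible factor cannot also end in a joint, since both sides of that joint are
   non-empty. *)
- move=> hx /refined_factorization_rcons[hy /factor_order z0 ep].
  have := refined_factorization_head hx; case: hx => _; rewrite ep /= => <- fx.
  by case: (factor_joint fx (refined_factorization_order hy) z0).
- move=> /refined_factorization_rcons[hx /factor_order z0 ep] hy.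
  have := refined_factorization_head hy; case: hy => _; rewrite ep /= => <- fy.
  by case: (factor_joint fy (refined_factorization_order hx) z0).
move=> /refined_factorization_rcons[hx fz ->].
move=> /refined_factorization_rcons[hy fz' e].
have xt0 := refined_factorization_order hx.
have yu0 := refined_factorization_order hy.
case: (ltngtP (diagram_order (eval_fact x t)) (diagram_order (eval_fact y u))).
- move=> lt; have [r r0 er] := joint_common_factor e xt0 lt.
  by rewrite er in fz; case: (factor_joint fz r0 (factor_order fz')).
- move=> lt; have [r r0 er] := joint_common_factor (esym e) yu0 lt.
  by rewrite er in fz'; case: (factor_joint fz' r0 (factor_order fz)).
(* With equal last cuts, the last joint and factor cancel and induction applies to the rest. *)
move=> eqo; have [-> ext ->] := joint_cancel xt0 (factor_order fz) eqo e.
by rewrite -ext in hy; have [-> ->] := IH _ _ hx hy.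
Qed.

Lemma refined_factorization_cat o p q x t y u :
  refined_factorization p x t -> refined_factorization q y u ->
  refined_factorization (apply_joint o p q) x (t ++ (o, y) :: u).
Proof.
move=> [hx ->] [hy ->]; split; last first.
  by rewrite eval_fact_cat // (factor_order (hy _ (mem_head _ _))).
move=> w; rewrite /fact_factors /unzip2 map_cat -cat_cons mem_cat.
by case/orP; [apply: hx|apply: hy].
Qed.

(** Strong induction on the order: either some operation splits [p] into two smaller non-empty
    diagrams, or [p] is itself a factor. *)
Lemma refined_factorization_exists p : (0 < diagram_order p)%N ->
  exists x t, refined_factorization p x t.
Proof.
have [n] := ubnP (diagram_order p); elim: n p => // n IH p pn p0.
case: (pselect (exists o q r, [/\ p = apply_joint o q r, (0 < diagram_order q)%N &
                   (0 < diagram_order r)%N])) => [[o [q [r [e q0 r0]]]]|irr].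
  move: pn; rewrite e order_joint => pn.
  have [||x [t xt]] := IH q; [lia|lia|].
  have [||y [u yu]] := IH r; [lia|lia|].
  by exists x, (t ++ (o, y) :: u); apply: refined_factorization_cat.
exists p, [::]; split=> // y; rewrite inE => /eqP ->.
have h o q r : p = apply_joint o q r -> q = empty_diagram \/ r = empty_diagram.
  move=> e; apply: contrapT => /not_orP[/diagram_nonempty q0 /diagram_nonempty r0].
  by apply: irr; exists o, q, r.
by split; [apply/diagram_nonempty|apply: (h Tensor)|apply: (h Bullet)].
Qed.

(** * Tensor factorizations and the tensor length *)

Lemma tensor0 p : tensor empty_diagram p = p.
Proof.
apply: eq_diagram => // b i c j _ _.
by rewrite (linked_joint Tensor) /= !subn0.
Qed.

Lemma tensor_p0 p : tensor p empty_diagram = p.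
Proof.
apply: eq_diagram => [|b i c j]; first by rewrite /= addn0.
rewrite /= addn0 -/(diagram_order p) => ip jp.
by rewrite (linked_joint Tensor) /= ip jp.
Qed.

Lemma foldr_tensor_cat s1 s2 :
  foldr tensor empty_diagram (s1 ++ s2) =
  tensor (foldr tensor empty_diagram s1) (foldr tensor empty_diagram s2).
Proof.
elim: s1 => [|x s1 /= ->]; first by rewrite tensor0.
(* Associativity requires a non-empty middle factor, so an empty fold is treated apart. *)
have [q0|] := posnP (diagram_order (foldr tensor empty_diagram s1)); last first.
  by move/(@joint_assoc Tensor Tensor) => /= ->.
have -> : foldr tensor empty_diagram s1 = empty_diagram.
  by apply: contrapT => /diagram_nonempty; rewrite q0.
by rewrite tensor0 tensor_p0.
Qed.

(** Existence ensures that the list chosen in [tensor_length] is a genuine factorization and not the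
    default [[::]]. *)
Lemma tensor_factorization_exists p : exists s, tensor_factorization p s.
Proof.
have [n] := ubnP (diagram_order p); elim: n p => // n IH p pn.
have [p0|p0] := posnP (diagram_order p).
  exists [::]; split=> //; apply: contrapT => /diagram_nonempty.
  by rewrite p0.
case: (pselect (exists q r, [/\ p = tensor q r, (0 < diagram_order q)%N &
                   (0 < diagram_order r)%N])) => [[q [r [e q0 r0]]]|irr].
  move: pn; rewrite e (order_joint Tensor) => pn.
  have [|s [hs es]] := IH q; first lia.
  have [|s' [hs' es']] := IH r; first lia.
  exists (s ++ s'); split; last by rewrite foldr_tensor_cat -es -es'.
  by move=> x; rewrite mem_cat => /orP[/hs|/hs'].
exists [:: p]; split; last by rewrite /= tensor_p0.
move=> x; rewrite inE => /eqP ->; split; first exact/diagram_nonempty.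
move=> q r e; apply: contrapT => /not_orP[/diagram_nonempty q0 /diagram_nonempty r0].
by apply: irr; exists q, r.
Qed.

Definition tensor_count (t : seq (joint * diagram)) : nat :=
  count (fun ox => ~~ is_bullet ox.1) t.

(** Cutting at a tensor joint would write [p] as a tensor product of two non-empty diagrams. *)
Lemma tensor_irreducible_count p x t : tensor_irreducible p ->
  refined_factorization p x t -> tensor_count t = 0%N.
Proof.
move=> irr [hx ep]; apply/eqP; rewrite -leqn0 leqNgt -has_count; apply/negP.
move=> /split_find sp; case: sp ep hx => -[o y] t1 t2; case: o => // _ _.
rewrite cat_rcons => ep hx.
have fx : factor x := hx x (mem_head _ _).
have fy : factor y.
  by apply: hx; rewrite /fact_factors /unzip2 map_cat inE mem_cat mem_head !orbT.
have y0 := factor_order fy.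
have := irr (eval_fact x t1) (eval_fact y t2).
rewrite ep (eval_fact_cat _ _ Tensor _ y0) => /(_ erefl)[]; apply/diagram_nonempty.
  exact: leq_trans (factor_order fx) (order_eval_fact _ _).
exact: leq_trans y0 (order_eval_fact _ _).
Qed.

(* Refining each factor of a tensor factorization introduces only bullets. *)
Lemma refine_tensor_factorization p s : (0 < diagram_order p)%N ->
  tensor_factorization p s ->
  exists x t, refined_factorization p x t /\ size s = (tensor_count t).+1.
Proof.
elim: s p => [|y s IH] p p0 [hs ep]; first by rewrite ep in p0.
have [/diagram_nonempty y0 irr] : y <> empty_diagram /\ tensor_irreducible y.
  by apply: hs; rewrite mem_head.
have [x1 [t1 r1]] := refined_factorization_exists y0.
have c1 := tensor_irreducible_count irr r1.
have hs' x : x \in s -> x <> empty_diagram /\ tensor_irreducible x.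
  by move=> xs; apply: hs; rewrite inE xs orbT.
(* A one-term list adds no tensor; otherwise a single tensor joins the refinement of [y], which
   contains none, to that of the remaining factors. *)
case: s IH hs hs' ep => [_ _ _ /= | z s IH hs hs' ep].
  by rewrite tensor_p0 => ->; exists x1, t1; rewrite c1.
have q0 : (0 < diagram_order (foldr tensor empty_diagram (z :: s)))%N.
  have [/diagram_nonempty z0 _] := hs' z (mem_head _ _).
  exact: leq_trans z0 (leq_addr _ _).
have [x2 [t2 [r2 e2]]] := IH _ q0 (conj hs' erefl).
exists x1, (t1 ++ (Tensor, x2) :: t2); split.
  by rewrite ep; apply: (@refined_factorization_cat Tensor).
by rewrite [size _]/= -/(size (z :: s)) e2 /tensor_count count_cat /= -!/(tensor_count _) c1.
Qed.

(** The chosen tensor factorization refines to a refined factorization, which by uniqueness is the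
    given one. *)
Lemma tensor_length_count p x t :
  refined_factorization p x t -> tensor_length p = (tensor_count t).+1.
Proof.
move=> xt; have p0 := refined_factorization_order xt.
have [s hs] := tensor_factorization_exists p.
have hg := xgetI [::] hs; rewrite /tensor_length.
have [y [u [yu ->]]] := refine_tensor_factorization p0 hg.
by have [_ ->] := refined_factorization_unique yu xt.
Qed.

(** * Diagrams with prescribed factors *)

(** Encoding the joints by a finite function turns sums over diagrams with fixed factors into sums
    over a finite type, where products and sums can be exchanged. *)
Definition joints_of (ys : seq diagram) (b : {ffun 'I_(size ys) -> bool}) :
    seq (joint * diagram) :=
  [seq (if b i then Tensor else Bullet, tnth (in_tuple ys) i)
     | i <- enum 'I_(size ys)].

Lemma unzip2_joints_of ys b : unzip2 (@joints_of ys b) = ys.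
Proof.
rewrite /unzip2 /joints_of -map_comp.
by rewrite -[RHS]/(tval (in_tuple ys)) -[RHS]map_tnth_enum.
Qed.

Lemma nth_joints_of ys b (i : 'I_(size ys)) :
  nth Bullet (unzip1 (@joints_of ys b)) i = if b i then Tensor else Bullet.
Proof.
rewrite /unzip1 /joints_of -map_comp (nth_map i) ?size_enum_ord //.
by rewrite nth_ord_enum.
Qed.

Lemma size_joints_of ys b : size (@joints_of ys b) = size ys.
Proof. by rewrite size_map size_enum_ord. Qed.

Lemma joints_of_inj ys : injective (@joints_of ys).
Proof.
move=> b c e; apply/ffunP => i.
have := nth_joints_of b i; rewrite e nth_joints_of.
by case: (b i); case: (c i).
Qed.

Lemma joints_ofP t : exists b, t = @joints_of (unzip2 t) b.
Proof.
pose n := size (unzip2 t).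
have nE : n = size t by rewrite /n size_map.
exists [ffun i => ~~ is_bullet (nth Bullet (unzip1 t) (i : 'I_n))].
rewrite -[LHS]zip_unzip -[RHS]zip_unzip unzip2_joints_of; congr zip.
apply: (@eq_from_nth _ Bullet) => [|i].
  by rewrite size_map [RHS]size_map size_joints_of -nE.
rewrite size_map -nE => iN; rewrite (nth_joints_of _ (Ordinal iN)) ffunE /=.
by case: nth.
Qed.

Lemma subset_fact_tensors ys (b c : {ffun 'I_(size ys) -> bool}) :
  (fact_tensors (joints_of b) `<=` fact_tensors (joints_of c))%classic <->
  [forall i, b i ==> c i].
Proof.
split=> [h|/forallP h i].
  apply/forallP => i; apply/implyP => bi.
  (* Tensor positions are numbered from 1, the entries of the vectors from 0. *)
  have := h i.+1; rewrite /fact_tensors /= !size_joints_of !nth_joints_of bi.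
  by rewrite ltn_ord => /(_ (conj erefl erefl)) [_]; case: (c i).
case: i => [[]//|i]; rewrite /fact_tensors /= !size_joints_of => -[iN].
rewrite (nth_joints_of b (Ordinal iN)) (nth_joints_of c (Ordinal iN)).
by move: (h (Ordinal iN)); case: (b _) => //= ->.
Qed.

Lemma tensor_count_joints_of ys b :
  tensor_count (@joints_of ys b) = (\sum_i b i)%N.
Proof.
rewrite /tensor_count count_map -big_enum /= -sum1_count big_mkcond /=.
by apply: eq_bigr => i _; case: (b i).
Qed.

(** Uniqueness replaces the existentially quantified factorizations by the given ones. *)
Lemma refinesE p q y t z u :
  refined_factorization p y t -> refined_factorization q z u ->
  refines p q <-> fact_factors y t = fact_factors z u /\
                  (fact_tensors u `<=` fact_tensors t)%classic.
Proof.
have ne p' y' t' : refined_factorization p' y' t' -> p' <> empty_diagram.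
  by move=> /refined_factorization_order /diagram_nonempty.
move=> hp hq; split=> [[[]|[_ _ [y' [z' [t' [u' [hp' hq']]]]]]]|[e s]].
- by move/ne: hp.
- have [<- <-] := refined_factorization_unique hp hp'.
  by have [<- <-] := refined_factorization_unique hq hq'.
right; split; [exact: ne hp|exact: ne hq|by exists y, z, t, u].
Qed.

Section FixedFactors.

Variables (x : diagram) (ys : seq diagram).
Hypothesis factors : forall y, y \in x :: ys -> factor y.

Implicit Types b c : {ffun 'I_(size ys) -> bool}.

(* [b i] says whether the [i]-th joint is a tensor. *)
Definition compose b := eval_fact x (joints_of b).

Lemma compose_refined b : refined_factorization (compose b) x (joints_of b).
Proof. by split=> //; rewrite /fact_factors unzip2_joints_of. Qed.

Lemma compose_inj : injective compose.
Proof.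
move=> b c e; have := compose_refined c; rewrite -e => r.
have [_] := refined_factorization_unique (compose_refined b) r.
exact: joints_of_inj.
Qed.

Lemma compose_nonempty b : compose b <> empty_diagram.
Proof.
exact/diagram_nonempty/(refined_factorization_order (compose_refined b)).
Qed.

(** The finer diagram has more tensors, so the order on vectors is reversed. *)
Lemma refines_compose b c :
  refines (compose b) (compose c) <-> [forall i, c i ==> b i].
Proof.
apply: iff_trans (refinesE (compose_refined b) (compose_refined c)) _.
apply: iff_trans (subset_fact_tensors c b).
by rewrite /fact_factors !unzip2_joints_of; split=> [[]|].
Qed.

Lemma refines_composeE p c :
  refines p (compose c) -> exists b, p = compose b.
Proof.
case=> [[_ /compose_nonempty]//|[_ _ [y [z [t [u [hp hq e _]]]]]]].
have [xz eu] := refined_factorization_unique (compose_refined c) hq.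
move: e; rewrite -xz -eu /fact_factors unzip2_joints_of => -[yx tys].
have [b et] := joints_ofP t; move: hp => [_ ->]; rewrite yx et.
(* The type of [b] depends on the list of factors, so [b] is generalized before that list is
   replaced by [ys]. *)
by move: b {et}; rewrite tys => b; exists b.
Qed.

End FixedFactors.

(** * Coefficients, the pairing and signs *)

Section Coefficients.

Variable K : fieldType.
Implicit Types p q : diagram.

Lemma mcoeff_fsum (A : set diagram) (a : diagram -> K) q : finite_set A ->
  (\sum_(s \in A) a s *: (<< s >> : {malg K[diagram]}))@_q =
  if `[< A q >] then a q else 0.
Proof.
move=> fA; rewrite fsbig_finite // raddf_sum /=.
case: asboolP => Aq; last first.
  apply: big1_fset => s sA _; rewrite mcoeffZ mcoeffU.
  case: eqP => [sq|]; last by rewrite mulr0.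
  by case: Aq; rewrite -sq; apply: set_mem; rewrite -in_fset_set.
rewrite (bigD1_seq q) ?fset_uniq ?in_fset_set ?inE //= big1 ?addr0.
  by rewrite mcoeffZ mcoeffU eqxx mulr1.
by move=> s /negbTE sq; rewrite mcoeffZ mcoeffU sq mulr0.
Qed.

Lemma mcoeff_Lpar p q : (Lpar K p)@_q = `[< refines q p >]%:R.
Proof.
have -> : Lpar K p = \sum_(s \in [set s | refines s p]%classic) 1 *: Mpar K s.
  by apply: eq_fsbigr => s _; rewrite scale1r.
by rewrite (mcoeff_fsum _ _ (finite_refining p)) /=; case: ifP.
Qed.

Lemma mcoeff_Rpar p q :
  (Rpar K p)@_q = if `[< refines p q >]
    then (-1) ^ ((tensor_length q)%:Z - (tensor_length p)%:Z) else 0.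
Proof. by rewrite (mcoeff_fsum _ _ (finite_coarsening p)). Qed.

(** Any duplicate-free list containing the support of [f] may index the pairing; below it lists the
    diagrams with fixed factors. *)
Lemma pairing_uniq (r : seq diagram) f g : uniq r ->
  (forall p, f@_p != 0 -> p \in r) ->
  @pairing K f g = \sum_(p <- r) f@_p * g@_p.
Proof.
move=> ur fr; rewrite (@pairingEw _ (seq_fset tt r)).
  by apply: perm_big; apply: uniq_perm => // p; rewrite seq_fsetE.
by apply/fsubsetP => p; rewrite -mcoeff_neq0 seq_fsetE => /fr.
Qed.

(** Since -1 is its own inverse, the negative part of the exponent may change sign. *)
Lemma sign_exprz (m n : nat) : (-1 : K) ^ (m%:Z - n%:Z) = (-1) ^+ m * (-1) ^+ n.
Proof.
by rewrite expfzDr ?oppr_eq0 ?oner_eq0 // -exprz_inv invrN1.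
Qed.

End Coefficients.


(* Each joint contributes its own factor to the sum over [d], so the sum is a
   product of sums over a single joint; one of these is [1 - 1] or empty as
   soon as [b] and [c] differ. *)
Lemma sum_signs (K : fieldType) n (b c : {ffun 'I_n -> bool}) :
  \sum_(d : {ffun 'I_n -> bool}) [forall i, b i ==> d i]%:R *
    (if [forall i, d i ==> c i]
     then (-1) ^+ (\sum_i d i) * (-1) ^+ (\sum_i c i) else 0) =
  (b == c)%:R :> K.
Proof.
pose F i v : K := if (b i ==> v) && (v ==> c i) then (-1) ^+ v * (-1) ^+ c i else 0.
transitivity (\sum_(d : {ffun 'I_n -> bool}) \prod_i F i (d i)).
  apply: eq_bigr => d _.
  (* If either inequality fails at some [i], the [i]-th factor of the product is zero, and so is the
     left side. *)
  case: (boolP [forall i, b i ==> d i]) => [/forallP bd|/forallPn[i bd]]; last first.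
    by rewrite mul0r (bigD1 i) //= /F (negbTE bd) mul0r.
  case: (boolP [forall i, d i ==> c i]) => [/forallP dc|/forallPn[i dc]]; last first.
    by rewrite mulr0 (bigD1 i) //= /F (negbTE dc) andbF mul0r.
  rewrite mul1r -!prodrXr -big_split /=; apply: eq_bigr => i _.
  by rewrite /F bd dc.
(* When [b = c], only the value [c i] survives at each joint and contributes a squared sign, that is
   1. *)
rewrite -bigA_distr_bigA; have [bc|bc] := eqVneq b c.
  apply: big1 => i _; rewrite big_bool /F bc.
  by case: (c i); rewrite /= ?addr0 ?add0r ?mulrNN mulr1.
have [i bci] : exists i, b i != c i.
  by apply/existsP; apply: contraNT bc => /existsPn h; apply/eqP/ffunP => i;
     apply/eqP/negbNE/h.
rewrite (bigD1 i) //= big_bool /F; move: bci.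
case: (b i) (c i) => [] [] //= _; rewrite ?addr0 ?mul0r //.
by rewrite expr1 expr0 mul1r mulrNN mulr1 subrr mul0r.
Qed.

Theorem proposition4p3 (K : fieldType) (rho pi : diagram) :
  pairing (Lpar K rho) (Rpar K pi) = (rho == pi)%:R.
Proof.
(* The empty diagram has no refined factorization and is related only to itself, so it is handled
   separately. *)
have [rho0|rho0] := posnP (diagram_order rho).
  have -> : rho = empty_diagram.
    by apply: contrapT => /diagram_nonempty; rewrite rho0.
  rewrite (@pairing_uniq _ [:: empty_diagram]) // => [|p]; last first.
    rewrite mcoeff_Lpar; case: asboolP => [[[-> _] _|[]//]|_].
      by rewrite inE.
    by rewrite eqxx.
  rewrite big_seq1 mcoeff_Lpar mcoeff_Rpar asboolT; last by left.
  rewrite mul1r; case: asboolP => [[[-> _]|[]//]|npi].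
    by rewrite subrr expr0z eqxx.
  by case: eqP => // epi; case: npi; left; rewrite -epi.
have [x [t [xt erho]]] := refined_factorization_exists rho0.
have [b et] := joints_ofP t; rewrite /fact_factors in xt.
(* From here on the factors [x :: ys] of [rho] are fixed, and [b] records its joints. *)
move: (unzip2 t) b et xt => ys b et factors.
have {erho et} -> : rho = compose x b by rewrite erho et.
have uniq_ys : uniq [seq compose x d | d <- enum {ffun 'I_(size ys) -> bool}].
  by rewrite map_inj_uniq ?enum_uniq //; apply: compose_inj.
(* Every diagram refining [rho] has the same factors, so the support of [Lpar K rho] lies in the
   list. *)
rewrite (pairing_uniq _ uniq_ys) => [|p]; last first.
  rewrite mcoeff_Lpar; case: asboolP => [|_]; last by rewrite eqxx.
  by case/(refines_composeE factors) => d -> _; rewrite map_f ?mem_enum.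
rewrite big_map big_enum /=.
(* If [pi] has other factors, it refines no diagram of the list, so every term vanishes. *)
case: (pselect (exists c, pi = @compose x ys c)) => [[c ->]|npi]; last first.
  rewrite big1 => [|d _].
    by case: eqP => // e; case: npi; exists b.
  rewrite mcoeff_Rpar; case: asboolP => [|_]; last by rewrite mulr0.
  by case/(refines_composeE factors) => c ec; case: npi; exists c.
rewrite (inj_eq (compose_inj factors)) -sum_signs; apply: eq_bigr => d _.
have refE (d1 d2 : {ffun _}) : `[< refines (@compose x ys d1) (@compose x ys d2) >] =
    [forall i, d2 i ==> d1 i].
  by apply/asboolP/idP; case: (refines_compose factors d1 d2).
rewrite mcoeff_Lpar mcoeff_Rpar !refE sign_exprz.
(* Each tensor length exceeds the number of tensors by one; the two extra signs cancel. *)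
rewrite !(tensor_length_count (compose_refined factors _)).
by rewrite !tensor_count_joints_of !exprS mulrACA mulrNN mulr1 mul1r.
Qed.
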